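(* Let $n = p^2$, where $p \geq 5$ is a prime number. Then the energy of the line graph $L(\Gamma(\mathbb{Z}_{p^2}))$ is $E(L(\Gamma(\mathbb{Z}_{p^2}))) = 2p^2-10p+8$.
   Context: For a positive integer $n$, $\mathbb{Z}_n$ is the ring of residue classes modulo $n$. The zero-divisor graph $\Gamma(\mathbb{Z}_n)$ is the simple undirected graph whose vertices are the nonzero zero-divisors of $\mathbb{Z}_n$ (nonzero $x \in \mathbb{Z}_n$ such that $xy = 0$ for some nonzero $y \in \mathbb{Z}_n$), with distinct vertices $x,y$ adjacent if and only if $xy=0$. The line graph $L(\Gamma(\mathbb{Z}_n))$ is the graph whose vertices are the edges of $\Gamma(\mathbb{Z}_n)$, two distinct vertices being adjacent if the corresponding edges share a common vertex in $\Gamma(\mathbb{Z}_n)$. The energy $E(G)$ of a finite graph $G$ is the sum of the absolute values of the eigenvalues (counted with multiplicity) of its adjacency matrix. *)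

(* Defs.v *)
From HB Require Import structures.
From mathcomp Require Import all_boot all_order all_algebra.

Set Implicit Arguments.
Unset Strict Implicit.
Unset Printing Implicit Defensive.

Import GRing.Theory Num.Theory.
Local Open Scope ring_scope.

Record sgraph := SGraph {
  vertex : finType;
  adj : rel vertex;
  adj_sym : symmetric adj;
  adj_irrefl : irreflexive adj
}.

Section ZeroDivisorGraph.
Variable R : finComNzRingType.

Definition nonzero_zero_divisor : pred R :=
  fun x => (x != 0) && [exists y : R, (y != 0) && (x * y == 0)].

Definition zdg_vertex : finType := {x : R | nonzero_zero_divisor x}.

Definition zdg_adj : rel zdg_vertex :=
  fun x y => (x != y) && (val x * val y == 0).

Lemma zdg_adj_sym : symmetric zdg_adj.
Proof. by move=> x y; rewrite /zdg_adj eq_sym mulrC. Qed.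

Lemma zdg_adj_irrefl : irreflexive zdg_adj.
Proof. by move=> x; rewrite /zdg_adj eqxx. Qed.

Definition zero_divisor_graph : sgraph := SGraph zdg_adj_sym zdg_adj_irrefl.

End ZeroDivisorGraph.

Section LineGraph.
Variable G : sgraph.

Definition is_edge : pred {set vertex G} :=
  fun e => [exists x, exists y, adj x y && (e == [set x; y])].

Definition edge : finType := {e : {set vertex G} | is_edge e}.

Definition line_adj : rel edge :=
  fun e f => (e != f) && (val e :&: val f != set0).

Lemma line_adj_sym : symmetric line_adj.
Proof. by move=> e f; rewrite /line_adj eq_sym setIC. Qed.

Lemma line_adj_irrefl : irreflexive line_adj.
Proof. by move=> e; rewrite /line_adj eqxx. Qed.

Definition line_graph : sgraph := SGraph line_adj_sym line_adj_irrefl.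

End LineGraph.

Section Energy.
Variable C : numClosedFieldType.

(* The choice of ordering of the vertices is immaterial: another one gives a
   permutation-similar matrix. *)
Definition adjacency_matrix (G : sgraph) : 'M[C]_#|vertex G| :=
  \matrix_(i, j) (adj (enum_val i) (enum_val j))%:R.

(* All roots of the characteristic polynomial, each repeated according to its
   multiplicity: [closed_field_poly_normal p] provides s such that
   p = lead_coef p *: \prod_(z <- s) ('X - z%:P). *)
Definition spectrum n (A : 'M[C]_n) : seq C :=
  sval (closed_field_poly_normal (char_poly A)).

(* The matrix is real symmetric, so the eigenvalues, taken here in C, are real
   and the norm of C is their absolute value. *)
Definition energy (G : sgraph) : C :=
  \sum_(z <- spectrum (adjacency_matrix G)) `|z|.

End Energy.

(* Main.v *)
(** The nonzero zero-divisors of Z_(p^2) are its m = p - 1 nonzero non-units,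
    any two of which have product 0, so the zero-divisor graph is complete.  If
    B is the incidence matrix of a graph and A is the adjacency matrix of its
    line graph, then B^T B = A + 2 I, while B B^T = (m - 2) I + J for a complete
    graph, J = u u^T being the all-ones matrix.  Sylvester's identity
    c^n det (c I - A B) = c^m det (c I - B A), used once for B^T B and once for
    u u^T, gives the characteristic polynomial of A: its roots are 2m - 4,
    m - 4 with multiplicity m - 1, and -2 with multiplicity m (m - 3) / 2. *)

Require Import Defs.
From HB Require Import structures.
From mathcomp Require Import all_boot all_order all_algebra.
From mathcomp Require Import ring zify.

Set Implicit Arguments.
Unset Strict Implicit.
Unset Printing Implicit Defensive.

Import GRing.Theory Num.Theory.
Local Open Scope ring_scope.

(** * Determinants and spectra *)

Lemma det_scalar_sub_mulmxC (R : comNzRingType) m n (c : R)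
    (A : 'M_(m, n)) (B : 'M_(n, m)) :
  c ^+ n * \det (c%:M - A *m B) = c ^+ m * \det (c%:M - B *m A).
Proof.
(* Block elimination evaluates [\det M] in two ways: clearing [B] by column operations leaves
   [c%:M - A *m B]. *)
pose M := block_mx c%:M A B 1%:M.
have <- : \det M = \det (c%:M - A *m B).
  have : M *m block_mx 1%:M 0 (- B) 1%:M = block_mx (c%:M - A *m B) A 0 1%:M.
    by rewrite mulmx_block !mulmx1 !mulmx0 !mul1mx !add0r mulmxN subrr.
  move/(congr1 determinant).
  by rewrite det_mulmx det_lblock det_ublock !det1 !mulr1.
(* Row operations clear [B] after the lower rows are scaled by [c]; this is the source of [c ^+ n],
   and [c] need not be invertible. *)
rewrite -(mul1r (c ^+ n)) -(det1 R m) -(det_scalar n c).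
rewrite -(det_lblock _ (- B)) -det_mulmx.
rewrite mulmx_block !mul1mx !mul0mx !addr0 !mulmx1 mulNmx.
by rewrite mul_scalar_mx mul_mx_scalar addNr det_ublock det_scalar mulNmx addrC.
Qed.

(* The extra roots [s] let Sylvester's identity be used without cancelling the
   powers of [c] on its two sides. *)
Lemma sum_norm_spectrum (C : numClosedFieldType) n (A : 'M[C]_n) (s t : seq C) :
    char_poly A * \prod_(z <- s) ('X - z%:P) = \prod_(z <- t) ('X - z%:P) ->
  \sum_(z <- spectrum A) `|z| + \sum_(z <- s) `|z| = \sum_(z <- t) `|z|.
Proof.
rewrite /spectrum; case: closed_field_poly_normal => r /= char_r eq_st.
rewrite -big_cat; apply/perm_big/prod_XsubC_eq.
by rewrite big_cat -eq_st char_r (monicP (char_poly_monic A)) scale1r.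
Qed.

(** * Incidence matrices and their Gram matrices *)

Section Incidence.
Variable G : sgraph.
Implicit Types (x y : vertex G) (e f : edge G).

Lemma edgeP e : exists x y, adj x y /\ val e = [set x; y].
Proof.
by case: e => e /= /existsP[x /existsP[y /andP[xy /eqP e_xy]]]; exists x, y.
Qed.

Lemma adj_neq x y : adj x y -> x != y.
Proof. by apply: contraTneq => ->; rewrite adj_irrefl. Qed.

Lemma card_edge e : #|val e| = 2%N.
Proof. by have [x [y [/adj_neq xy ->]]] := edgeP e; rewrite cards2 xy. Qed.

(** These are the entries of B^T B. Two distinct 2-sets share at most one element. *)
Lemma card_meet_edge e f :
  #|val e :&: val f| = ((e == f).*2 + line_adj e f)%N.
Proof.
rewrite /line_adj; case: eqVneq => [<- | ne_ef] /=.
  by rewrite setIid card_edge.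
have: (#|val e :&: val f| < 2)%N.
  rewrite -(card_edge e) ltn_neqAle subset_leq_card ?subsetIl // andbT.
  apply: contra ne_ef => /eqP card_ef.
  rewrite -val_eqE /= eqEcard !card_edge leqnn andbT.
  apply/setIidPl/eqP; rewrite eqEcard subsetIl /=; exact: eq_leq.
by rewrite -cards_eq0; case: #|_| => [|[]].
Qed.

Lemma card_edges_through x y :
  x != y -> #|[set e : edge G | (x \in val e) && (y \in val e)]| = adj x y.
Proof.
move=> xy; case: (boolP (adj x y)) => adj_xy.
  have e_xy : is_edge [set x; y].
    by apply/existsP; exists x; apply/existsP; exists y; rewrite adj_xy eqxx.
  rewrite [RHS]/= -(cards1 (Sub [set x; y] e_xy : edge G)); apply: eq_card => e.
  rewrite !inE -val_eqE /= [RHS]eq_sym eqEcard cards2 xy card_edge andbT.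
  by rewrite subUset !sub1set.
apply/eqP; rewrite cards_eq0; apply/set0Pn => -[e]; rewrite inE.
have [u [v [adj_uv ->]]] := edgeP e; rewrite !inE.
have adj_vu : adj v u by rewrite adj_sym.
by case/andP=> /orP[]/eqP xE /orP[]/eqP yE; move: xy adj_xy;
   rewrite xE yE ?eqxx ?adj_uv ?adj_vu.
Qed.

(** Double counting of the pairs (e, y) with y the other end of an edge e at x. *)
Lemma card_edges_at x :
  #|[set e : edge G | x \in val e]| = #|[set y | adj x y]|.
Proof.
transitivity (\sum_(e : edge G | x \in val e) \sum_(y | y \in val e :\ x) 1)%N.
  rewrite -sum1_card; apply: eq_big => [e | e]; first by rewrite inE.
  rewrite inE sum1_card => xe.
  by have := cardsD1 x (val e); rewrite xe card_edge => -[].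
rewrite (exchange_big_dep (fun y => y != x)) /=; last first.
  by move=> e y _; rewrite !inE => /andP[].
rewrite -sum1_card (big_mkcond (fun y => y \in _)) [LHS]big_mkcond /=.
apply: eq_bigr => y _; rewrite inE; case: eqVneq => [-> | yx] /=.
  by rewrite adj_irrefl.
transitivity #|[set e : edge G | (x \in val e) && (y \in val e)]|.
  by rewrite -sum1_card; apply: eq_bigl => e; rewrite !inE yx.
by rewrite card_edges_through 1?eq_sym //; case: adj.
Qed.

Variable C : numClosedFieldType.

Definition incidence_matrix : 'M[C]_(#|vertex G|, #|edge G|) :=
  \matrix_(i, j) (enum_val i \in val (enum_val j : edge G))%:R.

Lemma tr_incidence_mul :
  incidence_matrix^T *m incidence_matrix =
  adjacency_matrix C (line_graph G) + 2%:M.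
Proof.
apply/matrixP => i j; rewrite !mxE.
transitivity (#|val (enum_val i : edge G) :&: val (enum_val j : edge G)|%:R : C).
  rewrite -sum1_card natr_sum [RHS]big_mkcond /=.
  rewrite [RHS](reindex (enum_val : 'I_#|vertex G| -> vertex G)) /=; last first.
    exact: onW_bij (enum_val_bij _).
  by apply: eq_bigr => k _; rewrite !mxE inE -natrM mulnb; case: ifP.
rewrite card_meet_edge (inj_eq enum_val_inj) addnC natrD; congr (_ + _).
by case: eqP => _; rewrite ?mulr1n ?mulr0n.
Qed.

Lemma incidence_mul_tr i j :
  (incidence_matrix *m incidence_matrix^T) i j =
  #|[set e : edge G | (enum_val i \in val e) && (enum_val j \in val e)]|%:R.
Proof.
rewrite mxE -sum1_card natr_sum [RHS]big_mkcond /=.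
rewrite [RHS](reindex (enum_val : 'I_#|edge G| -> edge G)) /=; last first.
  exact: onW_bij (enum_val_bij _).
by apply: eq_bigr => k _; rewrite !mxE inE -natrM mulnb; case: ifP.
Qed.

End Incidence.

(** * Line graph of a complete graph *)

Section CompleteGraph.
Variables (C : numClosedFieldType) (G : sgraph).
Hypothesis complete : forall x y : vertex G, adj x y = (x != y).
Local Notation m := #|vertex G|.
Local Notation B := (incidence_matrix G C).

Lemma card_nbr_complete (x : vertex G) : #|[set y | adj x y]| = m.-1.
Proof.
rewrite -(cardC1 x); apply: eq_card => y.
by rewrite !inE complete eq_sym.
Qed.

Lemma complete_incidence_mul_tr :
  B *m B^T = (m%:R - 2)%:M + (const_mx 1 : 'cV_m) *m (const_mx 1 : 'rV_m).
Proof.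
apply/matrixP => i j; rewrite incidence_mul_tr !mxE big_ord1 !mxE mulr1.
case: (eqVneq i j) => [<- | ij].
  under eq_finset do rewrite andbb.
  rewrite card_edges_at card_nbr_complete mulr1n -subn1 natrB; first by ring.
  (* The index [i] itself shows 1 <= m, so [m.-1] casts to m - 1. *)
  by apply/card_gt0P; exists (enum_val i).
have ij_val : enum_val i != enum_val j by rewrite (inj_eq enum_val_inj).
by rewrite mulr0n add0r card_edges_through // complete ij_val.
Qed.

(** B B^T and B^T B have the same trace: m (m - 2) + m on one side, twice the number of edges on the
    other, as A has zero diagonal. *)
Lemma card_edge_complete : 2 * #|edge G|%:R = m%:R * (m%:R - 1) :> C.
Proof.
have := mxtrace_mulC B B^T; rewrite complete_incidence_mul_tr tr_incidence_mul.
rewrite !mxtraceD !mxtrace_scalar mxtrace_mulC.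
have -> : \tr ((const_mx 1 : 'rV[C]_m) *m (const_mx 1 : 'cV_m)) = m%:R.
  rewrite /mxtrace big_ord1 mxE (eq_bigr (fun=> 1)) ?sumr_const ?card_ord //.
  by move=> i _; rewrite !mxE mulr1.
have -> : \tr (adjacency_matrix C (line_graph G)) = 0.
  by rewrite /mxtrace big1 // => i _; rewrite mxE adj_irrefl.
by rewrite -[(_ - _) *+ _]mulr_natr -[2 *+ _]mulr_natr add0r => <-; ring.
Qed.

Lemma char_poly_line_complete :
  char_poly (adjacency_matrix C (line_graph G)) *
    (('X + 2%:P) ^+ m * ('X - (m%:R - 4)%:P)) =
  ('X + 2%:P) ^+ #|edge G| *
    (('X - (m%:R - 4)%:P) ^+ m * ('X - (2 * m%:R - 4)%:P)).
Proof.
pose P := map_mx (@polyC C).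
have -> : char_poly (adjacency_matrix C (line_graph G)) =
    \det (('X + 2%:P)%:M - P _ _ B^T *m P _ _ B).
  rewrite -map_mxM tr_incidence_mul map_mxD map_scalar_mx raddfD /=.
  by rewrite opprD addrACA subrr addr0.
(* Sylvester's identity with c = X + 2. *)
rewrite [LHS]mulrCA [LHS]mulrA det_scalar_sub_mulmxC -mulrA; congr (_ * _).
rewrite -map_mxM complete_incidence_mul_tr map_mxD map_scalar_mx map_mxM /=.
rewrite opprD addrA -raddfB /=.
have -> : 'X + 2%:P - (m%:R - 2)%:P = 'X - (m%:R - 4)%:P :> {poly C}.
  by rewrite -addrA -polyCB -polyCN; congr ('X + _%:P); ring.
(* Sylvester's identity with c = X - (m - 4), for J = u u^T of inner dimension 1: what remains is
   the 1 x 1 determinant c - m. *)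
rewrite mulrC -{1}(expr1 ('X - _)) det_scalar_sub_mulmxC; congr (_ * _).
rewrite [_ - _]mx11_scalar det_scalar1 !mxE mulr1n.
rewrite (eq_bigr (fun=> 1)); last by move=> i _; rewrite !mxE mulr1.
rewrite sumr_const card_ord -polyC_natr -addrA -opprD -polyCD.
by congr ('X - _%:P); ring.
Qed.

Lemma energy_line_complete : (4 <= m)%N ->
  energy C (line_graph G) = 2 * m%:R ^+ 2 - 6 * m%:R.
Proof.
move=> m_ge4; have m4 : 4 <= m%:R :> C by rewrite (ler_nat C 4).
have m4_ge0 : 0 <= m%:R - 4 :> C by rewrite subr_ge0.
have m24_ge0 : 0 <= 2 * m%:R - 4 :> C.
  have -> : 2 * m%:R - 4 = m%:R + (m%:R - 4) :> C by ring.
  exact: addr_ge0.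
have prodXn k (z : C) : \prod_(w <- nseq k z) ('X - w%:P) = ('X - z%:P) ^+ k.
  by rewrite big_nseq iter_mulr_1.
have sumn k (z : C) : \sum_(w <- nseq k z) `|w| = k%:R * `|z|.
  by rewrite big_nseq iter_addr_0 mulr_natl.
(* The lists are the roots of the extra factors on the left of [char_poly_line_complete] and of its
   whole right side. *)
have := @sum_norm_spectrum C _ (adjacency_matrix C (line_graph G))
  (rcons (nseq m (- 2)) (m%:R - 4))
  (nseq #|edge G| (- 2) ++ rcons (nseq m (m%:R - 4)) (2 * m%:R - 4)).
rewrite -!cats1 !big_cat !big_seq1 /= !prodXn polyCN opprK.
rewrite char_poly_line_complete => /(_ erefl).
rewrite !sumn normrN (ger0_norm m4_ge0) (ger0_norm m24_ge0).
rewrite ger0_norm ?ler0n // [X in _ = X + _]mulrC card_edge_complete => E.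
apply: (addIr (m%:R * 2 + (m%:R - 4))); rewrite /energy E; ring.
Qed.

End CompleteGraph.

(** * Zero-divisors modulo the square of a prime *)

Section ZmodPrimeSquare.
Variable p : nat.
Hypothesis p_prime : prime p.
Local Notation R := 'Z_(p ^ 2).

Let psq_gt1 : (1 < p ^ 2)%N.
Proof. by rewrite (ltn_exp2l 0) ?prime_gt1. Qed.

Lemma unit_Zp_prime_square (x : R) : (x \is a GRing.unit) = ~~ (p %| x)%N.
Proof. by rewrite -{1}[x]natr_Zp unitZpE // coprime_pexpl // prime_coprime. Qed.

Lemma mul_nonunit_Zp_prime_square (x y : R) :
  x \isn't a GRing.unit -> y \isn't a GRing.unit -> x * y = 0.
Proof.
rewrite !unit_Zp_prime_square !negbK => /dvdnP[a xE] /dvdnP[b yE].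
rewrite -[x]natr_Zp -[y]natr_Zp xE yE -natrM mulnACA mulnn.
by rewrite natrM pchar_Zp ?mulr0.
Qed.

Lemma zero_divisor_Zp_prime_square (x : R) :
  nonzero_zero_divisor x = (x != 0) && (x \isn't a GRing.unit).
Proof.
rewrite /nonzero_zero_divisor; case: eqVneq => //= x0; apply/existsP/idP.
  case=> y /andP[y0 /eqP xy0]; apply: contra y0 => x_unit.
  by rewrite -(mulKr x_unit y) xy0 mulr0.
(* A nonunit annihilates itself, since p^2 divides its square. *)
by move=> xN; exists x; rewrite x0 mul_nonunit_Zp_prime_square ?eqxx.
Qed.

(** Of the p^2 residues, p (p - 1) are units by Euler's totient; removing 0 from the p others leaves
    p - 1. *)
Lemma card_zdg_vertex_prime_square : #|zdg_vertex R| = p.-1.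
Proof.
rewrite card_sig.
have eqU : #|[pred x : R | x \is a GRing.unit]| = (p.-1 * p)%N.
  rewrite -(expn1 p) -(totient_pfactor p_prime (isT : 0 < 2)%N).
  rewrite -card_units_Zp ?(ltnW psq_gt1) // /units_Zp cardsT card_sub.
  by apply: eq_card.
have := cardC [pred x : R | x \is a GRing.unit].
have -> : #|R| = (p ^ 2)%N by rewrite card_ord Zp_cast.
rewrite eqU.
rewrite (cardD1 0) !inE unitr0 /=.
have -> : #|[predD1 [predC [pred x : R | x \is a GRing.unit]] & 0]| =
          #|[pred x : R | nonzero_zero_divisor x]|.
  by apply: eq_card => x; rewrite !inE zero_divisor_Zp_prime_square.
move: #|_| => N.
by case: (p) (prime_gt0 p_prime) => // k _ /=; rewrite -mulnn; lia.
Qed.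

Lemma zero_divisor_graph_prime_square_complete
    (x y : vertex (zero_divisor_graph R)) : adj x y = (x != y).
Proof.
have nonunit (z : vertex (zero_divisor_graph R)) : val z \isn't a GRing.unit.
  by have := valP z; rewrite zero_divisor_Zp_prime_square => /andP[].
by rewrite /= /zdg_adj mul_nonunit_Zp_prime_square ?nonunit // eqxx andbT.
Qed.

End ZmodPrimeSquare.

Theorem theorem3p4 (C : numClosedFieldType) (p : nat)
    (p_prime : prime p) (p_ge5 : (5 <= p)%N) :
  energy C (line_graph (zero_divisor_graph 'Z_(p ^ 2))) =
    2 * p%:R ^+ 2 - 10 * p%:R + 8.
Proof.
have card_V := card_zdg_vertex_prime_square p_prime.
rewrite energy_line_complete; first 1 last.
- exact: zero_divisor_graph_prime_square_complete.
- by rewrite card_V; lia.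
(* Substitution of m = p - 1 in 2 m^2 - 6 m. *)
rewrite card_V -subn1 natrB ?prime_gt0 //; ring.
Qed.
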